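(* Let $I=[0,1]$. There is a Li-Yorke non-chaotic continuous map $f:I\to I$ of type $2^\infty$ with a unique infinite minimal set $C$, and there are sequences $(\varepsilon_k)_k$, $(\varepsilon_k')_k$ of positive reals decreasing to zero, such that for every $x\in C$: $\mathrm{rdet}_\infty(x,\varepsilon_k)=1$ for every $k$, and $\lim_{k\to\infty}\overline{\mathrm{rdet}}_\infty(x,\varepsilon_k')=0$. Consequently, $$\limsup_{\varepsilon\to0}\underline{\mathrm{rdet}}_\infty(x,\varepsilon)=1\quad\text{and}\quad\liminf_{\varepsilon\to0}\overline{\mathrm{rdet}}_\infty(x,\varepsilon)=0\qquad\text{for every }x\in C.$$
   Context: $I=[0,1]$ carries the Euclidean metric $\varrho$. For $x,y\in I$ put $\varrho_\infty(x,y)=\sup_{i\ge 0}\varrho(f^i(x),f^i(y))$ and $\varrho_1=\varrho$. For $m\in\{1,\infty\}$, $x\in I$, $n\in\mathbb N$ and $\varepsilon>0$ let $$C_m(x,n,\varepsilon)=\frac1{n^2}\,\#\{(i,j): 0\le i,j<n,\ \varrho_m(f^i(x),f^j(x))\le\varepsilon\},\qquad \mathrm{rdet}_\infty(x,n,\varepsilon)=\frac{C_\infty(x,n,\varepsilon)}{C_1(x,n,\varepsilon)}.$$ Put $\underline{\mathrm{rdet}}_\infty(x,\varepsilon)=\liminf_{n\to\infty}\mathrm{rdet}_\infty(x,n,\varepsilon)$ and $\overline{\mathrm{rdet}}_\infty(x,\varepsilon)=\limsup_{n\to\infty}\mathrm{rdet}_\infty(x,n,\varepsilon)$. If they coincide,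 the common value is denoted $\mathrm{rdet}_\infty(x,\varepsilon)$; an equality $\mathrm{rdet}_\infty(x,\varepsilon)=c$ includes the assertion that the limit exists. A pair $(y,z)$ is scrambled if $\liminf_{n}\varrho(f^n(y),f^n(z))=0$ and $\limsup_n\varrho(f^n(y),f^n(z))>0$; a set $S$ is scrambled if every pair of distinct points of $S$ is scrambled; $f$ is Li-Yorke chaotic if it has an uncountable scrambled set, and Li-Yorke non-chaotic otherwise. The map $f$ is of type $2^\infty$ (in the sense of Sharkovsky's ordering) if the set of least periods of its periodic points is exactly $\{2^n:n\ge0\}$. A minimal set is a nonempty closed set $M\subseteq I$ with $f(M)\subseteq M$ having no proper subset with these properties. *)

(* Defs.v *)
From mathcomp Require Import all_boot all_order all_algebra.
From mathcomp Require Import all_classical all_reals all_analysis.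

Set Implicit Arguments.
Unset Strict Implicit.
Unset Printing Implicit Defensive.

Import Order.TTheory GRing.Theory Num.Theory.
Import numFieldNormedType.Exports.

Local Open Scope classical_set_scope.
Local Open Scope ring_scope.

Definition unit_itv (R : realType) : set R := `[0, 1]%classic.
Arguments unit_itv {R}.

(* A map f : I -> I is encoded by f : R -> R with f(I) `<=` I. Every notion
   below only evaluates f on orbits of points of I, so the values of f outside
   I play no role. *)
Definition continuous_self_map (R : realType) (f : R -> R) : Prop :=
  set_fun unit_itv unit_itv f /\ {within unit_itv, continuous f}.

Definition rho (R : realType) (x y : R) : R := `|x - y|.

(* For x, y in I the set below is bounded by 1, so this is a true supremum. *)
Definition rho_infty (R : realType) (f : R -> R) (x y : R) : R :=
  sup (range (fun i : nat => rho (iter i f x) (iter i f y))).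

Definition corr_sum (R : realType) (d : R -> R -> R) (f : R -> R)
    (x : R) (n : nat) (e : R) : R :=
  #|[pred p : 'I_n * 'I_n | d (iter p.1 f x) (iter p.2 f x) <= e]|%:R
    / n%:R ^+ 2.

Definition C_1 (R : realType) (f : R -> R) : R -> nat -> R -> R :=
  corr_sum (@rho R) f.

Definition C_infty (R : realType) (f : R -> R) : R -> nat -> R -> R :=
  corr_sum (rho_infty f) f.

(* For n = 0 this is the junk value 0 / 0 = 0; only limits n -> oo are used. *)
Definition rdet_infty (R : realType) (f : R -> R) (x : R) (n : nat) (e : R) :
    R :=
  C_infty f x n e / C_1 f x n e.

Definition lower_rdet (R : realType) (f : R -> R) (x e : R) : \bar R :=
  limn_einf (fun n : nat => (rdet_infty f x n e)%:E).

Definition upper_rdet (R : realType) (f : R -> R) (x e : R) : \bar R :=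
  limn_esup (fun n : nat => (rdet_infty f x n e)%:E).

(* The equality rdet_infty(x, e) = c, including the existence of the limit. *)
Definition rdet_eq (R : realType) (f : R -> R) (x e c : R) : Prop :=
  lower_rdet f x e = c%:E /\ upper_rdet f x e = c%:E.

Definition scrambled_pair (R : realType) (f : R -> R) (y z : R) : Prop :=
  limn_einf (fun n : nat => (rho (iter n f y) (iter n f z))%:E) = 0%E /\
  (0 < limn_esup (fun n : nat => (rho (iter n f y) (iter n f z))%:E))%E.

Definition scrambled_set (R : realType) (f : R -> R) (S : set R) : Prop :=
  forall y z : R, S y -> S z -> y <> z -> scrambled_pair f y z.

Definition li_yorke_chaotic (R : realType) (f : R -> R) : Prop :=
  exists S : set R, [/\ S `<=` unit_itv, ~ countable S & scrambled_set f S].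

Definition is_least_period (R : realType) (f : R -> R) (x : R) (p : nat) :
    Prop :=
  [/\ (0 < p)%N, iter p f x = x &
      forall q : nat, (0 < q < p)%N -> iter q f x <> x].

Definition type_2infty (R : realType) (f : R -> R) : Prop :=
  [set p : nat | exists2 x : R, unit_itv x & is_least_period f x p] =
  range (fun n : nat => (2 ^ n)%N).

Definition nonempty_closed_invariant (R : realType) (f : R -> R) (M : set R) :
    Prop :=
  [/\ M !=set0, closed M, M `<=` unit_itv & f @` M `<=` M].

Definition minimal_set (R : realType) (f : R -> R) (M : set R) : Prop :=
  nonempty_closed_invariant f M /\
  forall N : set R, nonempty_closed_invariant f N -> N `<=` M -> N = M.

Definition decreasing_to_zero (R : realType) (u : nat -> R) : Prop :=
  [/\ forall k : nat, 0 < u k, decreasing_seq u & u @ \oo --> (0 : R)].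

(* Main.v *)
Require Import Defs.
From mathcomp Require Import all_boot all_order all_algebra.
From mathcomp Require Import all_classical all_reals all_analysis.
From mathcomp Require Import ring lra zify.

Set Implicit Arguments.
Unset Strict Implicit.
Unset Printing Implicit Defensive.

Import Order.TTheory GRing.Theory Num.Theory.
Import numFieldNormedType.Exports.

Local Open Scope classical_set_scope.
Local Open Scope ring_scope.

(** The map is a Delahaye map with variable ratios.  Given ratios
    [0 < b_k <= a_k <= 1/4], a family [g_k] of self-maps of [0, 1] is determined
    by: [g_k] sends the left interval [0, a_k] increasingly and affinely onto
    the right interval [1 - b_k, 1]; it sends the right interval back into the
    left one as a rescaled copy of [g_{k+1}]; and it is affine, of slope below
    -1, in between.  So [g_k] exchanges the two intervals and its square on each
    of them is a copy of [g_{k+1}].  The map of the theorem is [f = g_0].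

    Iterating the renormalization [n] times gives [2 ^ n] level-[n] cylinders,
    which [f] permutes cyclically: with the binary digits of [i] read as
    left/right choices, [f] maps cylinder [i] into cylinder [i + 1] modulo
    [2 ^ n] ([cyl_step], [cyl_iter]).  The middle branch of [g_n] is expanding,
    so an orbit of [g_n] either lands on the fixed point of that branch or leaves
    the middle for ever ([escape_middle]).  Hence every orbit of [f] either lands
    on a periodic orbit of period some [2 ^ n], or enters the cylinders of every
    level ([settles_or_enters]).  Three facts follow.
    - Cylinders of the same level are a positive distance apart and their
      diameters tend to zero, so two orbits are either asymptotic or eventually
      separated by a positive distance ([asymptotic_or_distal]).  No pair is
      scrambled.
    - The least periods are exactly the powers of two ([renorm_map_type_2infty]).
    - A minimal set is either one of those finite orbits or the intersection [C]
      of all levels ([cantor_unique]).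

    On [C] the two correlation sums are counting problems.  Let
    [D_m = a_0 ... a_{m-1}], the length of the leftmost level-[m] cylinder and
    the largest length at that level.  Orbits in distinct level-[m] cylinders
    visit, at the last level where they agree, the leftmost cylinder at the same
    time, and there the two halves are more than [D_m] apart.  Therefore
    [rho_infty (f^i x) (f^j x) <= D_m] means exactly that [i = j] modulo [2 ^ m]
    ([rho_infty_diamE]), whatever the ratios are.  The Euclidean distance, in
    contrast, depends on them.
    - If [D_{q+1}] is smaller than every gap between level-[q+1] cylinders, it
      too only sees [i] and [j] modulo [2 ^ (q+1)], so the quotient is 1
      ([rdet_infty_eq1]).
    - If the cylinders of level [q+1] whose last digit is 1 are all of length at
      most [D_m], where [m > q], then the Euclidean count contains at least a
      proportion of order [2 ^ -q] of the pairs while the other one contains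
      [2 ^ -m]; the quotient is of order [2 ^ (q - m)] ([rdet_infty_small]).
    Both happen for all [q = 2 ^ k], with [m = 2 q], when the ratios are [1/4]
    except at the powers of two, where [a_q] is tiny compared with everything
    before and [b_q] is tiny compared with the [q] following lengths ([sparse]).
    The scales are [D_{2^k + 1}] and [D_{2^(k+1)}]. *)

Local Notation in01 x := (0 <= x <= 1).

(** * Renormalizable maps with variable ratios *)

Lemma ex_half_pow_le (R : realType) (e : R) : 0 < e -> exists n, 2^-1 ^+ n <= e.
Proof.
move=> e0; have : (2^-1 : R) ^+ n @[n --> \oo] --> (0 : R).
  by apply: cvg_expr; rewrite ger0_norm; lra.
move=> /cvgrPdist_le/(_ e e0)[n _ /(_ n (leqnn n))].
by rewrite /= sub0r normrN ger0_norm ?exprn_ge0// => ?; exists n.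
Qed.

Lemma dist_in01 (R : realType) (y z : R) : in01 y -> in01 z -> `|y - z| <= 1.
Proof.
by move=> /andP[? ?] /andP[? ?]; rewrite ler_norml; apply/andP; split; lra.
Qed.

Definition run_prod (R : realType) (u : nat -> R) (k n : nat) : R :=
  \prod_(k <= i < k + n) u i.

Section RunProd.
Context {R : realType}.
Implicit Types (u v : nat -> R) (k n : nat).

Lemma run_prod0 u k : run_prod u k 0 = 1.
Proof. by rewrite /run_prod addn0 big_geq. Qed.

Lemma run_prodSl u k n : run_prod u k n.+1 = u k * run_prod u k.+1 n.
Proof. by rewrite /run_prod big_ltn ?addnS ?ltnS ?leq_addr// addSn. Qed.

Lemma run_prodSr u k n : run_prod u k n.+1 = run_prod u k n * u (k + n)%N.
Proof. by rewrite /run_prod addnS big_nat_recr ?leq_addr. Qed.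

Lemma run_prod_gt0 u k n : (forall i, 0 < u i) -> 0 < run_prod u k n.
Proof. by move=> u0; rewrite /run_prod prodr_gt0. Qed.

End RunProd.

(** The relative lengths of the left and right halves at each level.  As [rgt] never
    exceeds [lft], the leftmost cylinder is the longest of its level; as both are
    at most [1/4], the gap in the leftmost cylinder is longer than every cylinder
    of a later level. *)
Record ratios (R : realType) := Ratios {
  lft : nat -> R;
  rgt : nat -> R;
  rgt_gt0 : forall k, 0 < rgt k;
  rgt_le_lft : forall k, rgt k <= lft k;
  lft_le4 : forall k, lft k <= 4^-1 }.

Section Map.
Context {R : realType} (w : ratios R).
Local Notation a := (lft w).
Local Notation b := (rgt w).
Implicit Types (n k : nat) (x y t : R) (G : R -> R).

Lemma lft_gt0 k : 0 < a k.
Proof. exact: lt_le_trans (rgt_gt0 w k) (rgt_le_lft w k). Qed.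

Lemma lft_run_le k n : run_prod a k n <= 2^-1 ^+ n.
Proof.
elim: n k => [|n IH] k; first by rewrite run_prod0.
rewrite run_prodSl exprS ler_pM ?(ltW (lft_gt0 k)) ?(ltW (run_prod_gt0 _ _ lft_gt0))//.
by have := lft_le4 w k; lra.
Qed.

(** The middle branch has to descend from [1] at [a k] to the value
    [a k * (1 - b k.+1)] that the right branch takes at [1 - b k]. *)
Definition slope k : R := (1 - a k * (1 - b k.+1)) / (1 - a k - b k).

Lemma gap_gt0 k : 2^-1 <= 1 - a k - b k.
Proof. have := lft_le4 w k; have := rgt_le_lft w k; lra. Qed.

Lemma slopeE k : slope k * (1 - a k - b k) = 1 - a k * (1 - b k.+1).
Proof. by rewrite divfK//; have := gap_gt0 k; lra. Qed.

(** The image of the gap covers the gap and more, whence expansion. *)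
Lemma slope_gt1 k : 1 < slope k.
Proof.
have := gap_gt0 k => g; rewrite /slope ltr_pdivlMr; last by lra.
have := lft_gt0 k; have := rgt_gt0 w k; have := rgt_gt0 w k.+1; nra.
Qed.

Definition renorm_step k (G : R -> R) (x : R) : R :=
  if x <= a k then 1 - b k + b k / a k * x
  else if x <= 1 - b k then 1 - slope k * (x - a k)
  else a k * G ((x - (1 - b k)) / b k).

(** The functional equation defines [g_k] through [g_{k+1}] and has no base case.
    Cutting the recursion off at [0] gives approximants that increase with the
    number of steps. *)
Fixpoint approx n k : R -> R :=
  if n is n'.+1 then renorm_step k (approx n' k.+1) else fun=> 0.

Definition renorm_map k (x : R) : R := limn (fun n => approx n k x).
Local Notation g := renorm_map.

Lemma in01_pull k x : in01 x -> 1 - b k < x -> in01 ((x - (1 - b k)) / b k).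
Proof.
move=> /andP[x0 x1] bx; have b0 := rgt_gt0 w k.
rewrite divr_ge0 ?ler_pdivrMr ?mul1r//=; lra.
Qed.

Lemma renorm_step_in01 k G x : (forall y, in01 y -> in01 (G y)) ->
  in01 x -> in01 (renorm_step k G x).
Proof.
move=> G01 x01; rewrite /renorm_step.
have b0 := rgt_gt0 w k; have a0 := lft_gt0 k; have a4 := lft_le4 w k.
have ba := rgt_le_lft w k.
case: ifPn => [xa|]; last rewrite -ltNge => ax.
  have : 0 <= x / a k <= 1.
    by move: x01 => /andP[x0 _]; rewrite divr_ge0 ?(ltW a0)//= ler_pdivrMr// mul1r.
  by rewrite mulrAC -mulrA => /andP[? ?]; apply/andP; split; nra.
case: ifPn => [xb|]; last rewrite -ltNge => bx.
  have s1 := slope_gt1 k; have sE := slopeE k.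
  have b4 := le_trans (rgt_le_lft w k.+1) (lft_le4 w k.+1).
  have bb := rgt_gt0 w k.+1.
  have : slope k * (x - a k) <= slope k * (1 - a k - b k).
    by rewrite ler_wpM2l//; lra.
  rewrite sE => ?; apply/andP; split; nra.
have /andP[? ?] := G01 _ (in01_pull x01 bx).
apply/andP; split; nra.
Qed.

Lemma approx_in01 n k x : in01 x -> in01 (approx n k x).
Proof.
elim: n k x => [|n IH] k x x01 /=; first by rewrite lexx ler01.
by apply: renorm_step_in01 => // y; exact: IH.
Qed.

Lemma approx_homo k x : in01 x -> nondecreasing_seq (fun n => approx n k x).
Proof.
move=> x01; apply/nondecreasing_seqP => n.
elim: n k x x01 => [|n IH] k x x01.
  by have /andP[] := approx_in01 1 k x01.
rewrite /= /renorm_step; case: ifP => // _; case: ifPn => //; rewrite -ltNge => bx.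
by rewrite ler_wpM2l ?(ltW (lft_gt0 k))//; apply: IH; exact: in01_pull.
Qed.

Lemma approx_cvg k x : in01 x -> approx n k x @[n --> \oo] --> g k x.
Proof.
move=> x01; apply: nondecreasing_is_cvgn; first exact: approx_homo.
by exists 1 => _ [n _ <-]; have /andP[] := approx_in01 n k x01.
Qed.

Lemma renorm_mapE k x : in01 x -> g k x = renorm_step k (g k.+1) x.
Proof.
move=> x01; suff c : approx n k x @[n --> \oo] --> renorm_step k (g k.+1) x.
  by apply: cvg_lim c; exact: norm_hausdorff.
rewrite -cvg_shiftS /= /renorm_step; case: ifP => [_|_]; first exact: cvg_cst.
case: ifPn => [_|]; first exact: cvg_cst.
rewrite -ltNge => bx.
by apply: cvgMr; apply: approx_cvg; exact: in01_pull.
Qed.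

Lemma renorm_map_in01 k x : in01 x -> in01 (g k x).
Proof.
move=> x01; have c := approx_cvg (k := k) x01; apply/andP; split.
  apply: limr_ge; first by apply/cvg_ex; eexists; exact: c.
  by apply: nearW => n; have /andP[] := approx_in01 n k x01.
apply: limr_le; first by apply/cvg_ex; eexists; exact: c.
by apply: nearW => n; have /andP[] := approx_in01 n k x01.
Qed.

Lemma renorm_map_left k t : in01 t -> g k (a k * t) = 1 - b k + b k * t.
Proof.
move=> /andP[t0 t1]; have a0 := lft_gt0 k; have a4 := lft_le4 w k.
rewrite renorm_mapE; last by apply/andP; split; nra.
rewrite /renorm_step ifT; last by nra.
by congr (_ + _); rewrite mulrA divfK// gt_eqF.
Qed.

Lemma renorm_map0 k : g k 0 = 1 - b k.
Proof.
rewrite -{1}(mulr0 (a k)) renorm_map_left ?mulr0 ?addr0//.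
by rewrite lexx ler01.
Qed.

Lemma renorm_map_mid k x : a k <= x <= 1 - b k ->
  g k x = 1 - slope k * (x - a k).
Proof.
move=> /andP[ax xb]; have a0 := lft_gt0 k; have b0 := rgt_gt0 w k.
rewrite renorm_mapE; last by apply/andP; split; lra.
rewrite /renorm_step xb; case: leP => // xa.
have -> : x = a k by lra.
by rewrite divfK ?gt_eqF//; lra.
Qed.

Lemma renorm_map_right k t : in01 t -> g k (1 - b k + b k * t) = a k * g k.+1 t.
Proof.
move=> /andP[]; rewrite le_eqVlt => /orP[/eqP <- _|t0 t1].
  rewrite mulr0 addr0 renorm_map_mid ?lexx ?andbT; last first.
    by have := gap_gt0 k; lra.
  by rewrite renorm_map0; have := slopeE k; lra.
have b0 := rgt_gt0 w k; have g0 := gap_gt0 k; have a0 := lft_gt0 k.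
rewrite renorm_mapE; last by apply/andP; split; nra.
rewrite /renorm_step !ifF; [|by apply/negbTE; rewrite -ltNge; nra..].
by congr (_ * g _ _); rewrite addrC addrA addNr add0r mulrC mulKf ?gt_eqF.
Qed.

Definition clamp (t : R) : R := Num.min 1 (Num.max 0 t).

Lemma clamp_in01 t : in01 (clamp t).
Proof. by rewrite /clamp le_min ge_min le_max lexx ler01 lexx. Qed.

Lemma clamp_le0 t : t <= 0 -> clamp t = 0.
Proof. by move=> t0; rewrite /clamp (max_l t0) (min_r ler01). Qed.

Lemma clamp_id t : in01 t -> clamp t = t.
Proof. by move=> /andP[t0 t1]; rewrite /clamp (max_r t0) (min_r t1). Qed.

Lemma clamp_ge1 t : 1 <= t -> clamp t = 1.
Proof. by move=> t1; rewrite /clamp max_r ?min_l// (le_trans ler01). Qed.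

Lemma clamp_lip s t : `|clamp s - clamp t| <= `|s - t|.
Proof.
wlog st : s t / t <= s.
  by move=> h; have [|/ltW] := leP t s => [/h//|/h]; rewrite distrC [leRHS]distrC.
rewrite (ger0_norm (_ : 0 <= s - t)) ?subr_ge0//.
have [t0|t0] := leP t 0; have [s0|s0] := leP s 0; have [t1|t1] := leP t 1;
  have [s1|s1] := leP s 1; rewrite ?(clamp_le0 t0) ?(clamp_le0 s0)
  ?(clamp_ge1 (ltW t1)) ?(clamp_ge1 (ltW s1)) ?(@clamp_id t) ?(@clamp_id s)
  ?ger0_norm//; lra.
Qed.

(** The three branches as one sum: every term but the last is Lipschitz, and the last
    is a copy of the next map shrunk by [a k].  No case analysis at the break
    points is then needed for continuity. *)
Lemma renorm_map_clampE k x : in01 x -> g k x =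
  1 - b k + b k * clamp (x / a k)
  - (1 - a k * (1 - b k.+1)) * clamp ((x - a k) / (1 - a k - b k))
  + a k * (g k.+1 (clamp ((x - (1 - b k)) / b k)) - (1 - b k.+1)).
Proof.
move=> x01; have b0 := rgt_gt0 w k; have a0 := lft_gt0 k.
have g0 : 0 < 1 - a k - b k by have := gap_gt0 k; lra.
rewrite renorm_mapE// /renorm_step; case: ifPn => [xa|]; last rewrite -ltNge => ax.
  rewrite (@clamp_id (x / a k)); last first.
    by move/andP: x01 => [x0 _]; rewrite divr_ge0 ?(ltW a0)//= ler_pdivrMr// mul1r.
  rewrite !clamp_le0; first by rewrite renorm_map0; ring.
  - by rewrite pmulr_lle0 ?invr_gt0//; lra.
  - by rewrite pmulr_lle0 ?invr_gt0//; lra.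
rewrite (@clamp_ge1 (x / a k)); last by rewrite ler_pdivlMr// mul1r ltW.
case: ifPn => [xb|]; last rewrite -ltNge => bx.
  rewrite clamp_id; last first.
    by rewrite divr_ge0 ?ler_pdivrMr ?mul1r//; lra.
  rewrite clamp_le0; first by rewrite renorm_map0 /slope; ring.
  by rewrite pmulr_lle0 ?invr_gt0//; lra.
rewrite clamp_ge1; last by rewrite ler_pdivlMr// mul1r; lra.
by rewrite (clamp_id (in01_pull x01 bx)); ring.
Qed.

(** The contribution of the next map is at most a quarter of its oscillation; asking
    for a half only leaves room for the Lipschitz terms. *)
Lemma renorm_map_osc n k x : in01 x -> exists2 d : R, 0 < d &
  forall y, in01 y -> `|x - y| < d -> `|g k x - g k y| <= 2^-1 ^+ n.
Proof.
elim: n k x => [|n IH] k x x01.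
  exists 1 => // y y01 _; rewrite expr0 ler_distl.
  by have /andP[] := renorm_map_in01 k x01; have /andP[] := renorm_map_in01 k y01; lra.
have b0 := rgt_gt0 w k; have a0 := lft_gt0 k; have a4 := lft_le4 w k.
have ba := rgt_le_lft w k; have g2 := gap_gt0 k.
have b'0 := rgt_gt0 w k.+1; have b'4 := le_trans (rgt_le_lft w k.+1) (lft_le4 w k.+1).
have [d d0 dP] := IH k.+1 _ (clamp_in01 ((x - (1 - b k)) / b k)).
have p0 : 0 < 2^-1 ^+ n :> R by apply: exprn_gt0; lra.
(* [b k * d] keeps the rescaled points within [d]; the Lipschitz terms add up
   to at most three times the distance. *)
exists (Num.min (b k * d) (2^-1 ^+ n / 12)).
  by rewrite lt_min mulr_gt0// divr_gt0.
move=> y y01; rewrite lt_min => /andP[xyd xyn].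
rewrite (renorm_map_clampE k x01) (renorm_map_clampE k y01).
set A := clamp _; set B := clamp _; set c := clamp _.
set A' := clamp _; set B' := clamp _; set c' := clamp _.
have hA : b k * `|A - A'| <= `|x - y|.
  apply: le_trans (ler_wpM2l (ltW b0) (clamp_lip _ _)) _.
  rewrite -mulrBl normrM normfV (gtr0_norm a0) mulrCA ler_piMr//.
  by rewrite ler_pdivrMr ?mul1r.
have hB : `|B - B'| <= 2 * `|x - y|.
  apply: le_trans (clamp_lip _ _) _.
  have -> : (x - a k) / (1 - a k - b k) - (y - a k) / (1 - a k - b k)
      = (1 - a k - b k)^-1 * (x - y) by ring.
  rewrite normrM ler_wpM2r// ger0_norm; last by rewrite invr_ge0; lra.
  by rewrite invf_ple ?posrE//; lra.
have hc : `|g k.+1 c - g k.+1 c'| <= 2^-1 ^+ n.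
  apply: dP; first exact: clamp_in01.
  apply: le_lt_trans (clamp_lip _ _) _.
  have -> : (x - (1 - b k)) / b k - (y - (1 - b k)) / b k = (x - y) / b k by ring.
  by rewrite normrM normfV (gtr0_norm b0) ltr_pdivrMr// mulrC.
have hA' : `|b k * (A - A')| <= `|x - y| by rewrite normrM gtr0_norm.
have hB' : `|(1 - a k * (1 - b k.+1)) * (B - B')| <= 2 * `|x - y|.
  by rewrite normrM (le_trans _ hB)// ler_piMl// ger0_norm; nra.
have hc' : `|a k * (g k.+1 c - g k.+1 c')| <= 4^-1 * 2^-1 ^+ n.
  by rewrite normrM gtr0_norm// ler_pM ?(ltW a0).
move: hA' hB' hc'; rewrite exprS !ler_norml => /andP[? ?] /andP[? ?] /andP[? ?].
by apply/andP; split; lra.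
Qed.

Lemma renorm_map_continuous k :
  {within `[0, 1]%classic, continuous (g k : R -> R)}.
Proof.
apply/subspace_continuousP => x /=; rewrite in_itv/= => x01.
apply/cvgrPdist_le => e e0.
have [n ne] := ex_half_pow_le e0.
have [d d0 dP] := renorm_map_osc n k x01.
apply/nbhs_ballP; exists d => // y xyd; rewrite /= in_itv/= => y01.
by apply: le_trans ne; exact: dP.
Qed.

End Map.

(** * Cylinders *)

(** The recursions on levels read the index one binary digit at a time, lowest first. *)
Lemma eqmod_pow2S n i j :
  (i == j %[mod 2 ^ n.+1])%N = (odd i == odd j) && (i./2 == j./2 %[mod 2 ^ n])%N.
Proof.
have [oij|/negbTE oij] /= := eqVneq (odd i) (odd j).
  rewrite -[in LHS](odd_double_half i) -[in LHS](odd_double_half j) oij.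
  by rewrite eqn_modDl -!mul2n expnS -!muln_modr eqn_pmul2l.
apply/negbTE/negP => /eqP /(congr1 odd).
by rewrite !odd_mod ?oddX// => /eqP; rewrite oij.
Qed.

Section Cylinders.
Context {R : realType} (w : ratios R).
Local Notation a := (lft w).
Local Notation b := (rgt w).
Local Notation g := (renorm_map w).
Implicit Types (n k i j : nat) (x y s t : R).

(** Affine parametrization by [0, 1] of a level-[n] cylinder of [g_k].  The binary
    digits of [i], lowest first, choose the left or the right interval, so only
    [i] modulo [2 ^ n] matters and the dynamics is the addition of [1] with
    carry. *)
Fixpoint cyl k n i t : R :=
  if n is n'.+1 then
    let u := cyl k.+1 n' i./2 t in
    if odd i then 1 - b k + b k * u else a k * u
  else t.

Lemma cylS k n i t : cyl k n.+1 i t =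
  if odd i then 1 - b k + b k * cyl k.+1 n i./2 t else a k * cyl k.+1 n i./2 t.
Proof. by []. Qed.

Lemma cyl_in01 k n i t : in01 t -> in01 (cyl k n i t).
Proof.
elim: n k i => [//|n IH] k i t01 /=.
have /andP[u0 u1] := IH k.+1 i./2 t01.
have a0 := lft_gt0 w k; have b0 := rgt_gt0 w k; have a4 := lft_le4 w k.
have ba := rgt_le_lft w k.
by case: ifP => _; apply/andP; split; nra.
Qed.

Lemma cyl_eqmod k n i j t :
  (i == j %[mod 2 ^ n])%N -> cyl k n i t = cyl k n j t.
Proof.
elim: n k i j => [//|n IH] k i j.
by rewrite eqmod_pow2S /= => /andP[/eqP -> /IH ->].
Qed.

(** A right digit is carried to a left one together with one step of the next map,
    a left digit becomes a right one and stops the carry.  The carry gets through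
    all [n] digits, and then acts as [g_{k+n}], when [2 ^ n] divides [i + 1]. *)
Lemma cyl_step k n i t : in01 t -> g k (cyl k n i t) =
  cyl k n i.+1 (if (2 ^ n %| i.+1)%N then g (k + n)%N t else t).
Proof.
elim: n k i => [|n IH] k i t01; first by rewrite dvd1n addn0.
have u01 := cyl_in01 k.+1 n i./2 t01.
have dE : (2 ^ n.+1 %| i.+1)%N = odd i && (2 ^ n %| (i./2).+1)%N.
  rewrite /dvdn -[X in (_ == X) = _](mod0n (2 ^ n.+1)) eqmod_pow2S mod0n /=.
  by rewrite uphalf_half eqbF_neg negbK; case: odd.
rewrite {}dE /= uphalf_half; case: (boolP (odd i)) => oi /=.
  by rewrite renorm_map_right// IH// add1n addSnnS.
by rewrite renorm_map_left.
Qed.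

Lemma cyl_iter k n i j t : in01 t -> iter j (g k) (cyl k n i t) =
  cyl k n (i + j) (iter ((i + j) %/ 2 ^ n - i %/ 2 ^ n) (g (k + n)%N) t).
Proof.
move=> t01; elim: j => [|j IH]; first by rewrite addn0 subnn.
rewrite iterS IH cyl_step; last first.
  by elim: (_ - _)%N => // m; exact: renorm_map_in01.
rewrite addnS; congr cyl.
by rewrite divnS ?expn_gt0//; case: dvdn; rewrite // add1n subSn// leq_div2r ?leq_addr.
Qed.

(** The recursion peels digits off from the outside; here the last digit is split off,
    which says how a cylinder of level [n] is subdivided. *)
Lemma cyl_catr k n i t :
  cyl k n.+1 i t = cyl k n i (cyl (k + n) 1 (i %/ 2 ^ n) t).
Proof.
elim: n k i => [|n IH] k i; first by rewrite addn0 divn1.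
by rewrite cylS IH [in RHS]cylS addSnnS expnS divnMA divn2.
Qed.

Lemma cyl_affine k n i : exists2 c, run_prod b k n <= c <= run_prod a k n &
  forall s t, cyl k n i s - cyl k n i t = c * (s - t).
Proof.
elim: n k i => [|n IH] k i.
  by exists 1 => [|s t]; rewrite ?run_prod0 ?lexx ?mul1r.
have [c /andP[Bc cA] cE] := IH k.+1 i./2; rewrite !run_prodSl /=.
have b0 := rgt_gt0 w k; have ba := rgt_le_lft w k.
have B0 := run_prod_gt0 k.+1 n (rgt_gt0 w).
exists ((if odd i then b k else a k) * c); last first.
  by move=> s t; rewrite -mulrA -cE; case: ifP => _; ring.
have c0 : 0 <= c by apply: le_trans Bc; exact: ltW.
have a0 := lft_gt0 w k.
by apply/andP; case: ifP => _; split; apply: ler_pM => //; exact: ltW.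
Qed.

Lemma cyl_dist_le k n i s t :
  `|cyl k n i s - cyl k n i t| <= run_prod a k n * `|s - t|.
Proof.
have [c /andP[Bc cA] ->] := cyl_affine k n i; rewrite normrM ler_wpM2r//.
by rewrite gtr0_norm// (lt_le_trans _ Bc)// run_prod_gt0//; exact: rgt_gt0.
Qed.

Lemma cyl_dist_ge k n i s t :
  run_prod b k n * `|s - t| <= `|cyl k n i s - cyl k n i t|.
Proof.
have [c /andP[Bc cA] ->] := cyl_affine k n i; rewrite normrM ler_wpM2r//.
by rewrite gtr0_norm// (lt_le_trans _ Bc)// run_prod_gt0//; exact: rgt_gt0.
Qed.

Lemma cyl_gap k n i j s t : in01 s -> in01 t -> odd i -> ~~ odd j ->
  1 - a k - b k <= cyl k n.+1 i s - cyl k n.+1 j t.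
Proof.
move=> s01 t01 /= -> /negbTE ->.
have /andP[u0 _] := cyl_in01 k.+1 n i./2 s01.
have /andP[_ v1] := cyl_in01 k.+1 n j./2 t01.
have := lft_gt0 w k; have := rgt_gt0 w k; nra.
Qed.

Lemma rgt_run_le1 k n : run_prod b k n <= 1.
Proof.
rewrite /run_prod prodr_ile1// => i _; rewrite ltW ?rgt_gt0//=.
by have := rgt_le_lft w i; have := lft_le4 w i; lra.
Qed.

Lemma cyl_sep_odd k n i j s t : in01 s -> in01 t -> odd i != odd j ->
  1 - a k - b k <= `|cyl k n.+1 i s - cyl k n.+1 j t|.
Proof.
move=> s01 t01; case: (boolP (odd i)) (boolP (odd j)) => oi [] oj // _.
  by apply: le_trans (ler_norm _); exact: cyl_gap.
by rewrite distrC; apply: le_trans (ler_norm _); exact: cyl_gap.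
Qed.

(** The gap at the first differing digit is at least [1/2] in its own scale; each of
    the at most [n] digits before it multiplies lengths by at least the right
    ratio. *)
Lemma cyl_sep k n i j s t : in01 s -> in01 t ->
  ~~ (i == j %[mod 2 ^ n.+1])%N ->
  2^-1 * run_prod b k n <= `|cyl k n.+1 i s - cyl k n.+1 j t|.
Proof.
move=> s01 t01; elim: n k i j => [|n IH] k i j;
    rewrite eqmod_pow2S; have [oij|oij _] := eqVneq (odd i) (odd j).
- by rewrite !modn1.
- by apply: le_trans (cyl_sep_odd k _ s01 t01 oij); rewrite run_prod0 mulr1 gap_gt0.
- rewrite [_ && _]/= => ij.
  have b0 := rgt_gt0 w k; have ba := rgt_le_lft w k.
  rewrite run_prodSl cylS [cyl k n.+2 j t]cylS -oij mulrCA.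
  apply: (@le_trans _ _ (b k * `|cyl k.+1 n.+1 i./2 s - cyl k.+1 n.+1 j./2 t|)).
    by rewrite ler_pM2l// IH.
  case: ifP => _; first by rewrite opprD addrACA subrr add0r -mulrBr normrM gtr0_norm.
  by rewrite -mulrBr normrM (gtr0_norm (lft_gt0 w k)) ler_wpM2r.
- apply: le_trans (cyl_sep_odd k _ s01 t01 oij); apply: le_trans (gap_gt0 w k).
  by rewrite ler_piMr// rgt_run_le1.
Qed.

End Cylinders.

(** * Trapping *)

Section Dynamics.
Context {R : realType} (w : ratios R).
Local Notation a := (lft w).
Local Notation b := (rgt w).
Local Notation g := (renorm_map w).
Local Notation cyl := (cyl w).
Implicit Types (n k i j : nat) (x y s t : R).

Definition mid_fix k : R := (1 + slope w k * a k) / (1 + slope w k).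

Lemma mid_fixE k : mid_fix k = 1 - slope w k * (mid_fix k - a k).
Proof.
have s1 := slope_gt1 w k.
have : mid_fix k * (1 + slope w k) = 1 + slope w k * a k.
  by rewrite /mid_fix divfK//; lra.
lra.
Qed.

Lemma mid_fix_bounds k : a k < mid_fix k < 1 - b k.
Proof.
have s1 := slope_gt1 w k; have sE := slopeE w k; have a0 := lft_gt0 w k.
have a4 := lft_le4 w k; have ba := rgt_le_lft w k; have b0 := rgt_gt0 w k.
have b'0 := rgt_gt0 w k.+1; have b'4 := le_trans (rgt_le_lft w k.+1) (lft_le4 w k.+1).
by rewrite /mid_fix ltr_pdivlMr ?ltr_pdivrMr; [apply/andP; split; nra|lra..].
Qed.

Lemma mid_fix_in01 k : in01 (mid_fix k).
Proof.
have /andP[? ?] := mid_fix_bounds k; have := lft_gt0 w k; have := rgt_gt0 w k.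
by move=> ? ?; apply/andP; split; lra.
Qed.

Lemma iter_mid_fix k j : iter j (g k) (mid_fix k) = mid_fix k.
Proof.
apply: iter_fix; have /andP[? ?] := mid_fix_bounds k.
by rewrite renorm_map_mid -?mid_fixE//; apply/andP; split; exact: ltW.
Qed.

Lemma iter_in01 k j x : in01 x -> in01 (iter j (g k) x).
Proof. by move=> x01; elim: j => // j; exact: renorm_map_in01. Qed.

(** Distances to the fixed point are multiplied by [slope > 1] as long as the orbit
    stays in the middle, and they are bounded by [1]. *)
Lemma escape_middle k x : in01 x ->
  (exists m, iter m (g k) x = mid_fix k) \/
  (exists m i t, in01 t /\ iter m (g k) x = cyl k 1 i t).
Proof.
move=> x01; have a0 := lft_gt0 w k; have b0 := rgt_gt0 w k.
have [[m [xa|bx]]|mid] := pselect (exists m,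
    iter m (g k) x <= a k \/ 1 - b k <= iter m (g k) x).
- have /andP[y0 y1] := iter_in01 k m x01.
  right; exists m, 0%N, (iter m (g k) x / a k); split.
    by rewrite divr_ge0 ?(ltW a0)//= ler_pdivrMr// mul1r.
  by rewrite /= mulrC divfK ?gt_eqF.
- have /andP[y0 y1] := iter_in01 k m x01.
  right; exists m, 1%N, ((iter m (g k) x - (1 - b k)) / b k); split.
    by rewrite divr_ge0 ?ler_pdivrMr ?mul1r//; lra.
  by rewrite /= mulrC divfK ?gt_eqF//; lra.
have {}mid m : a k <= iter m (g k) x <= 1 - b k.
  by apply/andP; split; rewrite leNgt; apply/negP => /ltW h; apply: mid; exists m;
    [left|right].
have s1 := slope_gt1 w k.
have expand m : `|iter m (g k) x - mid_fix k| = slope w k ^+ m * `|x - mid_fix k|.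
  elim: m => [|m IH]; first by rewrite expr0 mul1r.
  have -> : iter m.+1 (g k) x - mid_fix k = - slope w k * (iter m (g k) x - mid_fix k).
    by rewrite iterS renorm_map_mid//; have := mid_fixE k; lra.
  by rewrite normrM normrN (gtr0_norm (lt_trans ltr01 s1)) IH exprS mulrA.
left; exists 0%N => /=; apply/eqP; rewrite -subr_eq0 -normr_eq0.
apply/negPn/negP => xp; have {xp}d0 : 0 < `|x - mid_fix k| by rewrite lt_def xp /=.
have grow m : slope w k ^+ m >= 1 + (slope w k - 1) * m%:R.
  elim: m => [|m IH]; first by rewrite mulr0 addr0 expr0.
  rewrite exprS -natr1; have m0 : 0 <= m%:R :> R by [].
  have h2 : 0 <= (slope w k - 1) * (slope w k - 1) * m%:R by rewrite !mulr_ge0//; lra.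
  have : slope w k * (1 + (slope w k - 1) * m%:R) <= slope w k * slope w k ^+ m.
    by rewrite ler_wpM2l//; lra.
  by lra.
have q0 : 0 < (slope w k - 1) * `|x - mid_fix k| by rewrite mulr_gt0// subr_gt0.
(* by [grow], [m] steps expand the distance beyond 1 *)
set m := Num.bound ((slope w k - 1) * `|x - mid_fix k|)^-1.
have mq : 1 < (slope w k - 1) * `|x - mid_fix k| * m%:R.
  by rewrite -ltr_pdivrMl// mulr1; apply: archi_boundP; rewrite invr_ge0 ltW.
have : `|iter m (g k) x - mid_fix k| <= 1.
  have /andP[? ?] := iter_in01 k m x01; have /andP[? ?] := mid_fix_in01 k.
  by rewrite ler_norml; apply/andP; split; lra.
have := grow m; rewrite expand; nra.
Qed.

(** Landing on the periodic orbit of period [2 ^ n].  The whole tail is described, so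
    that two orbits can be compared time by time; a single landing time suffices
    ([settlesI]). *)
Definition settles n x := exists N i, forall j,
  iter (N + j) (g 0) x = cyl 0 n (i + j) (mid_fix n).

Definition enters n x := exists N i, forall j, exists2 t, in01 t &
  iter (N + j) (g 0) x = cyl 0 n (i + j) t.

Lemma entersI n x N i t : in01 t -> iter N (g 0) x = cyl 0 n i t -> enters n x.
Proof.
move=> t01 xE; exists N, i => j; rewrite addnC iterD xE cyl_iter//.
by eexists; last by []; exact: iter_in01.
Qed.

Lemma settlesI n x N i : iter N (g 0) x = cyl 0 n i (mid_fix n) -> settles n x.
Proof.
move=> xE; exists N, i => j; rewrite addnC iterD xE cyl_iter ?mid_fix_in01//.
by rewrite iter_mid_fix.
Qed.

Lemma settles_enters n x : settles n x -> enters n x.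
Proof.
move=> [N [i xE]]; apply: (@entersI _ _ N i (mid_fix n)).
  exact: mid_fix_in01.
by rewrite -(addn0 N) xE addn0.
Qed.

Lemma enters_pred n x : enters n.+1 x -> enters n x.
Proof.
move=> [N [i /(_ 0%N)[t t01]]]; rewrite !addn0 cyl_catr => xE.
by apply: entersI xE; exact: cyl_in01.
Qed.

Lemma enters_le n m x : (m <= n)%N -> enters n x -> enters m x.
Proof.
by elim: n => [|n IH]; rewrite leq_eqVlt => /predU1P[->//|//]; move=> /IH h /enters_pred.
Qed.

(** By induction on the level: returns to a level-[n] cylinder are iterates of [g_n],
    to which [escape_middle] applies. *)
Lemma settles_or_enters x : in01 x ->
  (exists n, settles n x) \/ forall n, enters n x.
Proof.
move=> x01; have [|nset] := pselect (exists n, settles n x); first by left.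
right; elim => [|n [N [i /(_ 0%N)[t t01]]]].
  by apply: (@entersI 0 x 0 0 x).
rewrite !addn0 => xE.
have ret m : iter (m * 2 ^ n + N) (g 0) x = cyl 0 n i (iter m (g n) t).
  rewrite iterD xE cyl_iter// divnDMl ?expn_gt0// addKn.
  by apply: cyl_eqmod; rewrite addnC modnMDl.
have [[m mE]|[m [j [s [s01 sE]]]]] := escape_middle n t01.
  exfalso; apply: nset; exists n.
  by apply: (@settlesI n x (m * 2 ^ n + N) i); rewrite ret mE.
apply: (@entersI n.+1 x (m * 2 ^ n + N) (i %% 2 ^ n + j * 2 ^ n) s) => //.
rewrite ret sE [RHS]cyl_catr divnDMl ?expn_gt0// divn_small ?ltn_mod ?expn_gt0// add0n.
by apply: cyl_eqmod; rewrite addnC modnMDl modn_mod.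
Qed.

End Dynamics.

(** * Absence of scrambled pairs *)

Section FilterLimits.
Context {T : choiceType} {X : filteredType T} {R : realType}.
Implicit Types (f : X -> \bar R) (F : set (set X)) (M : \bar R).
Local Open Scope ereal_scope.

Lemma limf_esup_le f F M : F [set x | f x <= M] -> limf_esup f F <= M.
Proof.
move=> FM; rewrite limf_esupE; apply: ge_ereal_inf.
exists (ereal_sup (f @` [set x | f x <= M])).
  by exists [set x | f x <= M].
by apply: ge_ereal_sup => _ [x fx <-].
Qed.

Lemma limf_esup_ge f F M :
  (forall V, F V -> exists2 x, V x & M <= f x) -> M <= limf_esup f F.
Proof.
move=> FM; rewrite limf_esupE; apply: le_ereal_inf_tmp => _ [V /FM[x Vx Mx] <-].
by apply: (le_trans Mx); apply: ereal_sup_ubound; exists x.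
Qed.

Lemma limf_einf_ge f F M : F [set x | M <= f x] -> M <= limf_einf f F.
Proof.
move=> FM; rewrite /limf_einf leeNr; apply: limf_esup_le.
by congr (F _): FM; apply/seteqP; split=> x /=; rewrite leeN2.
Qed.

Lemma limf_einf_le f F M :
  (forall V, F V -> exists2 x, V x & f x <= M) -> limf_einf f F <= M.
Proof.
move=> FM; rewrite /limf_einf leeNl; apply: limf_esup_ge => V /FM[x Vx xM].
by exists x => //; rewrite leeN2.
Qed.

End FilterLimits.

Section LiYorke.
Context {R : realType} (w : ratios R).
Local Notation a := (lft w).
Local Notation b := (rgt w).
Local Notation g := (renorm_map w).
Local Notation cyl := (cyl w).
Implicit Types (n k i j m : nat) (x y z s t : R).

Definition asymptotic y z := forall e : R, 0 < e -> exists N, forall j,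
  `|iter (N + j) (g 0) y - iter (N + j) (g 0) z| <= e.

Definition distal y z := exists2 e : R, 0 < e & exists N, forall j,
  e <= `|iter (N + j) (g 0) y - iter (N + j) (g 0) z|.

Lemma distalC y z : distal y z -> distal z y.
Proof. by move=> [e e0 [N h]]; exists e => //; exists N => j; rewrite distrC. Qed.

Lemma asymptotic_not_scrambled y z : asymptotic y z -> ~ scrambled_pair (g 0) y z.
Proof.
move=> A [_]; apply/negP; rewrite -leNgt; apply/lee_addgt0Pr => e /A[N h].
rewrite add0e; apply: limf_esup_le; exists N => // m /= Nm.
by rewrite lee_fin /rho -(subnKC Nm).
Qed.

Lemma distal_not_scrambled y z : distal y z -> ~ scrambled_pair (g 0) y z.
Proof.
move=> [e e0 [N h]] [inf0 _].
suff : (e%:E <= 0)%E by rewrite lee_fin leNgt e0.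
rewrite -{}inf0; apply: limf_einf_ge; exists N => // m /= Nm.
by rewrite lee_fin /rho -(subnKC Nm).
Qed.

Lemma cyl_apart n i j s t : in01 s -> in01 t -> ~~ (i == j %[mod 2 ^ n])%N ->
  2^-1 * run_prod b 0 n <= `|cyl 0 n i s - cyl 0 n j t|.
Proof.
case: n => [|n] s01 t01 ij; first by rewrite !modn1 in ij.
apply: le_trans (cyl_sep w 0 s01 t01 ij); rewrite run_prodSr mulrA ger_pMr.
  by have := rgt_le_lft w n; have := lft_le4 w n; lra.
by rewrite mulr_gt0// run_prod_gt0//; exact: rgt_gt0.
Qed.

(** From the sum of the two entry times on, each index absorbs the entry time of the
    other orbit. *)
Lemma enters_common n y z : enters w n y -> enters w n z ->
  exists N i i', forall j, exists s t, [/\ in01 s, in01 t,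
    iter (N + j) (g 0) y = cyl 0 n (i + j) s &
    iter (N + j) (g 0) z = cyl 0 n (i' + j) t].
Proof.
move=> [N [i yE]] [M [i' zE]]; exists (N + M)%N, (i + M)%N, (i' + N)%N => j.
have [s s01 sE] := yE (M + j)%N; have [t t01 tE] := zE (N + j)%N.
by exists s, t; split; rewrite // -?addnA// addnCA.
Qed.

(** Two orbits inside level [n] are either always in the same cylinder or never; the
    second case at one level already separates them. *)
Lemma enters_asymptotic_or_distal y z : (forall n, enters w n y) ->
  (forall n, enters w n z) -> asymptotic y z \/ distal y z.
Proof.
move=> Ey Ez; have [|nd] := pselect (distal y z); first by right.
left=> e e0.
have [n ne] : exists n, run_prod a 0 n <= e.
  have [n ne] := ex_half_pow_le e0; exists n.
  exact: le_trans (lft_run_le w 0 n) ne.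
have [N [i [i' h]]] := enters_common (Ey n) (Ez n).
have [ii|ii] := boolP (i == i' %[mod 2 ^ n])%N; last first.
  exfalso; apply: nd; exists (2^-1 * run_prod b 0 n).
    by rewrite mulr_gt0// run_prod_gt0//; exact: rgt_gt0.
  exists N => j; have [s [t [s01 t01 -> ->]]] := h j.
  by apply: cyl_apart => //; rewrite eqn_modDr.
exists N => j; have [s [t [s01 t01 -> ->]]] := h j.
rewrite -(@cyl_eqmod _ _ 0 n (i + j) (i' + j)) ?eqn_modDr//.
apply: le_trans (cyl_dist_le _ _ _ _ _ _) _; apply: le_trans ne.
rewrite ler_piMr ?(ltW (run_prod_gt0 _ _ (lft_gt0 w)))//.
exact: dist_in01.
Qed.

(** The periodic orbit of level [n] stays away from the level-[n+1] cylinders, either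
    because the level-[n] cylinders differ or because the middle fixed point is at
    a positive distance from both halves. *)
Lemma settles_enters_distal n y z :
  settles w n y -> enters w n.+1 z -> distal y z.
Proof.
move=> [N [i yE]] [M [i' zE]].
have B0 := run_prod_gt0 0 n (rgt_gt0 w).
have /andP[p1 p2] := mid_fix_bounds w n; have p01 := mid_fix_in01 w n.
set e := Num.min (mid_fix w n - a n) (1 - b n - mid_fix w n).
have e0 : 0 < e by rewrite lt_min !subr_gt0 p1.
exists (run_prod b 0 n * Num.min 2^-1 e).
  by rewrite mulr_gt0// lt_min e0 invr_gt0 ltr0n.
exists (N + M)%N => j; rewrite -addnA yE [(N + (M + j))%N]addnCA.
have [t t01 ->] := zE (N + j)%N; rewrite cyl_catr add0n.
set u := cyl n 1 _ t; have u01 : in01 u by exact: cyl_in01.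
have [ii|ii] := boolP (i + (M + j) == i' + (N + j) %[mod 2 ^ n])%N; last first.
  apply: le_trans (cyl_apart p01 u01 ii); rewrite mulrC ler_wpM2r ?(ltW B0)//.
  by rewrite ge_min lexx.
rewrite -(cyl_eqmod _ _ _ ii); apply: le_trans (cyl_dist_ge _ _ _ _ _ _).
rewrite ler_wpM2l ?(ltW B0)// ge_min; apply/orP; right.
rewrite /u cylS; case: ifP => _ /=.
  have := rgt_gt0 w n; move/andP: t01 => [t0 t1] bn0.
  rewrite ge_min; apply/orP; right; rewrite ler_normr; apply/orP; right; nra.
have := lft_gt0 w n; move/andP: t01 => [t0 t1] an0.
rewrite ge_min; apply/orP; left; rewrite ler_normr; apply/orP; left; nra.
Qed.

Lemma settles_asymptotic_or_distal n y z :
  settles w n y -> settles w n z -> asymptotic y z \/ distal y z.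
Proof.
move=> [N [i yE]] [M [i' zE]].
have p01 := mid_fix_in01 w n.
have [ii|ii] := boolP (i + M == i' + N %[mod 2 ^ n])%N.
  left=> e e0; exists (N + M)%N => j.
  rewrite -addnA yE [(N + (M + j))%N]addnCA zE.
  rewrite (@cyl_eqmod _ _ 0 n (i + (M + j)) (i' + (N + j))); last first.
    by rewrite !addnA eqn_modDr.
  by rewrite subrr normr0 ltW.
right; exists (2^-1 * run_prod b 0 n).
  by rewrite mulr_gt0// run_prod_gt0//; exact: rgt_gt0.
exists (N + M)%N => j; rewrite -addnA yE [(N + (M + j))%N]addnCA zE.
by apply: cyl_apart => //; rewrite !addnA eqn_modDr.
Qed.

(** Either alternative excludes that the pair is scrambled. *)
Lemma asymptotic_or_distal y z : in01 y -> in01 z -> asymptotic y z \/ distal y z.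
Proof.
move=> y01 z01.
have SE n y' z' : settles w n y' -> (forall m, enters w m z') -> distal y' z'.
  by move=> S E; exact: settles_enters_distal S (E _).
have SS n m y' z' : (n < m)%N -> settles w n y' -> settles w m z' -> distal y' z'.
  move=> nm S /settles_enters E; apply: settles_enters_distal S _.
  exact: enters_le nm E.
have [[n Sy]|Ey] := settles_or_enters w y01;
    have [[m Sz]|Ez] := settles_or_enters w z01.
- have [nm|mn|nm] := ltngtP n m.
  + by right; exact: SS nm Sy Sz.
  + by right; apply: distalC; exact: SS mn Sz Sy.
  + by apply: (@settles_asymptotic_or_distal n) => //; rewrite nm.
- by right; exact: SE Sy Ez.
- by right; apply: distalC; exact: SE Sz Ey.
- exact: enters_asymptotic_or_distal.
Qed.

Lemma not_li_yorke_chaotic : ~ li_yorke_chaotic (g 0).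
Proof.
move=> [S [S01 Sunc Sscr]]; apply: Sunc.
have [->|/set0P[x Sx]] := eqVneq S set0; first exact: countable0.
apply: sub_countable (countable1 x); apply: subset_card_le => y Sy /=.
apply: contrapT => yx; have := Sscr _ _ Sy Sx yx.
have S01' z : S z -> in01 z by move=> /S01; rewrite /unit_itv /= in_itv.
by have [/asymptotic_not_scrambled|/distal_not_scrambled] :=
  asymptotic_or_distal (S01' _ Sy) (S01' _ Sx).
Qed.

End LiYorke.

(** * Periods and minimal sets *)

Section PeriodsAndMinimalSets.
Context {R : realType} (w : ratios R).
Local Notation a := (lft w).
Local Notation b := (rgt w).
Local Notation g := (renorm_map w).
Local Notation cyl := (cyl w).
Implicit Types (n k i j m p : nat) (x y z s t : R).

Lemma cyl_eq_eqmod n i j s t : in01 s -> in01 t ->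
  cyl 0 n i s = cyl 0 n j t -> (i == j %[mod 2 ^ n])%N.
Proof.
move=> s01 t01 E; apply/negPn/negP => /(cyl_apart w s01 t01).
by rewrite E subrr normr0 leNgt mulr_gt0 ?run_prod_gt0//; exact: rgt_gt0.
Qed.

(** A cylinder of level [n] returns to itself only at multiples of [2 ^ n]. *)
Lemma cyl_return_dvd n i p t : in01 t ->
  iter p (g 0) (cyl 0 n i t) = cyl 0 n i t -> (2 ^ n %| p)%N.
Proof.
move=> t01; rewrite cyl_iter// => /cyl_eq_eqmod => /(_ (iter_in01 _ _ _ t01) t01).
by rewrite -[in X in _ == X](addn0 i) eqn_modDl mod0n.
Qed.

Lemma iter_mul_period x p m : iter p (g 0) x = x -> iter (m * p) (g 0) x = x.
Proof. by move=> px; elim: m => // m IH; rewrite mulSn iterD IH. Qed.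

Lemma settles_least_period n x p :
  settles w n x -> is_least_period (g 0) x p -> p = (2 ^ n)%N.
Proof.
move=> [N [i xE]] [p0 px lp].
have {xE} [i' xE] : exists i', x = cyl 0 n i' (mid_fix w n).
  exists (i + (N * p - N))%N; rewrite -xE subnKC ?leq_pmulr//.
  by rewrite iter_mul_period.
have p01 := mid_fix_in01 w n.
have dp : (2 ^ n %| p)%N by apply: (@cyl_return_dvd n i' p _ p01); rewrite -xE.
apply/eqP; rewrite eqn_leq (dvdn_leq p0 dp) andbT leqNgt; apply/negP => lt.
apply: (lp (2 ^ n)%N); first by rewrite expn_gt0.
rewrite {1}xE cyl_iter// iter_mid_fix xE; apply: cyl_eqmod.
by rewrite modnDr.
Qed.

Lemma enters_no_period x p :
  (forall n, enters w n x) -> ~ is_least_period (g 0) x p.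
Proof.
move=> /(_ p) [N [i xE]] [p0 px _].
have [t t01 tE] := xE (N * p - N)%N.
rewrite subnKC ?leq_pmulr// iter_mul_period// in tE.
have : (2 ^ p %| p)%N.
  by apply: (@cyl_return_dvd p (i + (N * p - N)) p t t01); rewrite -tE.
by move=> /(dvdn_leq p0); rewrite leqNgt ltn_expl.
Qed.

Lemma least_period_cyl_mid n :
  is_least_period (g 0) (cyl 0 n 0 (mid_fix w n)) (2 ^ n).
Proof.
have p01 := mid_fix_in01 w n; split; first by rewrite expn_gt0.
  by rewrite cyl_iter// iter_mid_fix; apply: cyl_eqmod; rewrite add0n modnn mod0n.
move=> q /andP[q0 q2] /(cyl_return_dvd p01)/(dvdn_leq q0).
by rewrite leqNgt q2.
Qed.

Lemma renorm_map_type_2infty : type_2infty (g 0).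
Proof.
rewrite /type_2infty; apply/seteqP; split => [p /= [x]|_ /= [n _ <-]].
  rewrite /unit_itv /= in_itv /= => x01 lp.
  have [[n Sx]|Ex] := settles_or_enters w x01.
    by exists n => //; rewrite (settles_least_period Sx lp).
  by have := enters_no_period Ex lp.
exists (cyl 0 n 0 (mid_fix w n)); last exact: least_period_cyl_mid.
by rewrite /unit_itv /= in_itv /=; apply: cyl_in01; exact: mid_fix_in01.
Qed.

Lemma renorm_map_self_map : continuous_self_map (g 0).
Proof.
split; last exact: renorm_map_continuous.
by move=> x; rewrite /unit_itv /= !in_itv/= => /renorm_map_in01.
Qed.

Definition level n : set R := [set x | exists i t, in01 t /\ x = cyl 0 n i t].

Definition cantor : set R := \bigcap_n level n.

Lemma level_closed n : closed (level n).
Proof.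
have -> : level n = \bigcup_(i in `I_(2 ^ n)) (cyl 0 n i @` `[0, 1]%classic).
  apply/seteqP; split => x /=.
    move=> [i [t [t01 ->]]]; exists (i %% 2 ^ n)%N; first by rewrite /= ltn_mod expn_gt0.
    exists t; first by rewrite /= in_itv.
    by apply: cyl_eqmod; rewrite modn_mod.
  by move=> [i _ [t]]; rewrite /= in_itv /= => t01 <-; exists i, t.
apply: closed_bigcup; first exact: finite_II.
move=> i _; apply: compact_closed; first exact: norm_hausdorff.
apply: continuous_compact; last exact: segment_compact.
apply: continuous_subspaceT => t.
have [c _ cE] := cyl_affine w 0 n i.
have -> : (cyl 0 n i : R -> R) = fun t => cyl 0 n i 0 + c * t.
  by apply/funext => u; have := cE u 0; lra.
by apply: cvgD; [exact: cvg_cst|apply: cvgMr; exact: cvg_id].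
Qed.

Lemma cantor_closed : closed cantor.
Proof. by apply: closed_bigI => n _; exact: level_closed. Qed.

Lemma cantor_in01 x : cantor x -> in01 x.
Proof. by move=> /(_ 0%N I)[i [t [t01 ->]]]. Qed.

Lemma cyl0 k n : cyl k n 0 0 = 0.
Proof. by elim: n k => //= n IH k; rewrite IH mulr0. Qed.

Lemma cantor0 : cantor 0.
Proof.
move=> n _; exists 0%N, 0; split; first by rewrite lexx ler01.
by rewrite cyl0.
Qed.

Lemma cantor_iter x j : cantor x -> cantor (iter j (g 0) x).
Proof.
move=> Cx n _; have [i [t [t01 ->]]] := Cx n I.
rewrite cyl_iter//; do 2!eexists; split; last by [].
exact: iter_in01.
Qed.

Lemma cantor_enters n x : cantor x -> enters w n x.
Proof.
by move=> /(_ n I)[i [t [t01 xE]]]; exact: (@entersI _ _ n x 0 i t).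
Qed.

(** An orbit that has entered level [n] visits all its cylinders, hence comes within
    their diameter of any given point of the Cantor set. *)
Lemma cantor_sub_closed_invariant (M : set R) x :
  closed M -> g 0 @` M `<=` M -> M x -> (forall n, enters w n x) -> cantor `<=` M.
Proof.
move=> clM invM Mx Ex c Cc.
have Mit j : M (iter j (g 0) x).
  by elim: j => // j IH; rewrite iterS; apply: invM; exists (iter j (g 0) x).
apply: clM => U /nbhs_ballP[e e0 eU].
have [n ne] := ex_half_pow_le (divr_gt0 e0 (ltr0n R 2)).
have [N [i xE]] := Ex n; have [i' [t [t01 cE]]] := Cc n I.
have [s s01 sE] := xE (i' + i * (2 ^ n).-1)%N.
(* this waiting time brings the index from [i] to [i'] modulo [2 ^ n] *)
exists (iter (N + (i' + i * (2 ^ n).-1)) (g 0) x); split; first exact: Mit.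
apply: eU; rewrite /ball/= sE cE (@cyl_eqmod _ _ 0 n _ i'); last first.
  by rewrite addnCA -mulnS prednK ?expn_gt0// addnC modnMDl.
apply: le_lt_trans (cyl_dist_le _ _ _ _ _ _) _.
apply: (@le_lt_trans _ _ (2^-1 ^+ n * 1)); last first.
  by rewrite mulr1 (le_lt_trans ne)// ltr_pdivrMr// ltr_pMr// ltr1n.
apply: ler_pM => //; first by rewrite ltW// run_prod_gt0//; exact: lft_gt0.
  exact: lft_run_le.
exact: dist_in01.
Qed.

Lemma cantor_invariant : nonempty_closed_invariant (g 0) cantor.
Proof.
split; [by exists 0; exact: cantor0|exact: cantor_closed| |].
  by move=> x /cantor_in01; rewrite /unit_itv /= in_itv.
by move=> _ [x Cx <-]; exact: (@cantor_iter x 1).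
Qed.

Lemma cantor_minimal : minimal_set (g 0) cantor.
Proof.
split=> [|N [[x Nx] clN _ invN] NC]; first exact: cantor_invariant.
apply/seteqP; split => //.
by apply: (cantor_sub_closed_invariant clN invN Nx) => n; apply: cantor_enters; exact: NC.
Qed.

(** The orbit of [0] is infinite: its points at two different times are in different
    cylinders of any level that distinguishes these times. *)
Lemma cantor_infinite : infinite_set cantor.
Proof.
move=> finC; apply: infinite_nat.
have inj : {in [set: nat] &, injective (fun j => iter j (g 0) 0)}.
  move=> i j _ _ /= ij; set n := (i + j)%N.
  have E m : iter m (g 0) 0 = cyl 0 n m (iter (m %/ 2 ^ n) (g n) 0).
    have -> : (0 : R) = cyl 0 n 0 0 by rewrite cyl0.
    by rewrite cyl_iter ?lexx ?ler01// add0n div0n subn0 cyl0.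
  have z01 m : in01 (iter m (g n) 0 : R) by apply: iter_in01; rewrite lexx ler01.
  have ltn m : (m <= n)%N -> (m < 2 ^ n)%N.
    by move=> mn; apply: leq_ltn_trans mn (ltn_expl _ _).
  move: ij; rewrite !E => /(cyl_eq_eqmod (z01 _) (z01 _)).
  by rewrite !modn_small ?ltn ?leq_addr ?leq_addl// => /eqP.
rewrite -(eq_finite_set (inj_card_eq inj)); apply: sub_finite_set finC.
by move=> _ [j _ <-]; apply: cantor_iter; exact: cantor0.
Qed.

Lemma orbit_set_finite n x : settles w n x -> exists N,
  finite_set (range (fun j => iter (N + j) (g 0) x)).
Proof.
move=> [N [i xE]]; exists N.
apply: (@sub_finite_set _ _ ((fun j => cyl 0 n j (mid_fix w n)) @` `I_(2 ^ n))).
  move=> _ [j _ <-]; exists ((i + j) %% 2 ^ n)%N; first by rewrite /= ltn_mod expn_gt0.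
  by rewrite xE; apply: cyl_eqmod; rewrite modn_mod.
exact/finite_image/finite_II.
Qed.

(** A minimal set contains an orbit closure; that of a settling orbit is finite, and
    that of any other orbit contains the Cantor set. *)
Lemma cantor_unique :
  unique (fun M : set R => minimal_set (g 0) M /\ infinite_set M) cantor.
Proof.
split=> [|M [[[[x Mx] clM M01 invM] minM] infM]].
  by split; [exact: cantor_minimal|exact: cantor_infinite].
have x01 : in01 x by have := M01 _ Mx; rewrite /unit_itv /= in_itv.
have Mit j : M (iter j (g 0) x).
  by elim: j => // j IH; rewrite iterS; apply: invM; exists (iter j (g 0) x).
have [[n Sx]|Ex] := settles_or_enters w x01; last first.
  apply: minM; first exact: cantor_invariant.
  exact: cantor_sub_closed_invariant clM invM Mx Ex.
exfalso; apply: infM; have [N finP] := orbit_set_finite Sx.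
set P := (X in finite_set X) in finP; have PM : P `<=` M by move=> _ [j _ <-]; exact: Mit.
rewrite -(minM P) //; split.
- by exists (iter (N + 0) (g 0) x), 0%N.
- apply: compact_closed; first exact: norm_hausdorff.
  exact: finite_compact.
- by move=> y /PM /M01.
- by move=> _ [_ [j _ <-] <-]; exists j.+1 => //; rewrite addnS.
Qed.

End PeriodsAndMinimalSets.

(** * Counting pairs of times *)

Section CountingPairs.
Local Open Scope nat_scope.
Implicit Types (n i j : nat).

(** The second component is determined by the first one and its own quotient by [M]. *)
Lemma card_eqmod_pairs_le n M : 0 < M ->
  #|[pred p : 'I_n * 'I_n | p.1 == p.2 %[mod M]]| <= n * (n %/ M).+1.
Proof.
move=> M0.
pose h (p : 'I_n * 'I_n) : 'I_n * 'I_(n %/ M).+1 := (p.1, inord (p.2 %/ M)).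
have -> : n * (n %/ M).+1 = #|{: 'I_n * 'I_(n %/ M).+1}| by rewrite card_prod !card_ord.
apply: (@leq_card_in _ _ h) => -[i j] [i' j']; rewrite !inE /= => /eqP ij /eqP ij'.
move=> [ii /(congr1 val)] /=.
have lej (l : 'I_n) : l %/ M < (n %/ M).+1 by rewrite ltnS leq_div2r// ltnW.
rewrite !inordK// => jj; congr (_, _) => //; apply: val_inj => /=.
by rewrite (divn_eq j M) (divn_eq j' M) jj -ij -ij' ii.
Qed.

(** [c] lists [S] residues modulo [N]; all pairs of times in the same listed residue
    class are counted, over the complete periods before [n]. *)
Lemma card_pairs_ge n N S (c : nat -> nat) (P : rel nat) :
  (forall s, c s < N) ->
  {in gtn S &, injective c} ->
  (forall u v s, s < S -> P (u * N + c s) (v * N + c s)) ->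
  (n %/ N) * (n %/ N) * S <= #|[pred p : 'I_n * 'I_n | P p.1 p.2]|.
Proof.
move=> cN cinj Pc; set T := n %/ N.
have lt_n (u : 'I_T) s : u * N + c s < n.
  by apply: (@leq_trans (u.+1 * N)); [rewrite mulSnr ltn_add2l|
     apply: leq_trans (leq_trunc_div n N); rewrite leq_mul2r ltn_ord orbT].
pose h (r : 'I_T * 'I_T * 'I_S) : 'I_n * 'I_n :=
  (Ordinal (lt_n r.1.1 r.2), Ordinal (lt_n r.1.2 r.2)).
have -> : T * T * S = #|{: 'I_T * 'I_T * 'I_S}| by rewrite !card_prod !card_ord.
have hinj : injective h.
  move=> [[u v] s] [[u' v'] s'] [] /= e1 e2.
  have /= N0 := leq_ltn_trans (leq0n _) (cN 0).
  have E1 : u = u' :> nat /\ c s = c s'.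
    have := congr1 (divn^~ N) e1; have := congr1 (modn^~ N) e1.
    by rewrite /= !modnMDl !divnMDl// !(divn_small (cN _)) !addn0 !modn_small.
  have E2 : v = v' :> nat.
    by have := congr1 (divn^~ N) e2; rewrite /= !divnMDl// !(divn_small (cN _)) !addn0.
  case: E1 => /val_inj -> /cinj; rewrite !inE !ltn_ord => /(_ isT isT) /val_inj ->.
  by rewrite (val_inj E2).
rewrite -(card_imset _ hinj); apply: subset_leq_card.
apply/fintype.subsetP => p /imsetP[r _ ->].
by rewrite inE; apply: Pc; exact: ltn_ord.
Qed.

(** Rounding costs a factor of [2] in [n %/ M] and in each [n %/ N], and half of the
    residues modulo [N] are listed, which makes [16]. *)
Lemma card_pairs_ratio n M N S A B :
  0 < M -> 0 < N -> N <= M -> N = 2 * S -> M <= n ->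
  A <= n * (n %/ M).+1 -> (n %/ N) * (n %/ N) * S <= B -> A * M <= 16 * N * B.
Proof.
move=> M0 N0 NM NS Mn AM BN.
have nM : (n %/ M).+1 * M <= 2 * n.
  by rewrite mulSn mul2n -addnn leq_add// leq_trunc_div.
have nN : n <= 2 * ((n %/ N) * N).
  have := divn_eq n N; have := ltn_pmod n N0.
  have : 0 < n %/ N by rewrite divn_gt0// (leq_trans NM).
  nia.
apply: (@leq_trans (2 * (n * n))).
  apply: leq_trans (_ : n * (n %/ M).+1 * M <= _); first by rewrite leq_mul2r AM orbT.
  by rewrite -mulnA [X in _ <= X]mulnCA leq_mul2l nM orbT.
apply: (@leq_trans (2 * ((2 * ((n %/ N) * N)) * (2 * ((n %/ N) * N))))).
  by rewrite leq_mul2l leq_mul.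
apply: (@leq_trans (16 * N * (n %/ N * (n %/ N) * S))); last by rewrite leq_mul2l BN orbT.
rewrite NS; nia.
Qed.

End CountingPairs.

(** * Correlation sums on the Cantor set *)

Section RecurrenceDeterminism.
Context {R : realType} (w : ratios R).
Local Notation a := (lft w).
Local Notation b := (rgt w).
Local Notation g := (renorm_map w).
Local Notation cyl := (cyl w).
Local Notation diam := (run_prod a 0).
Implicit Types (n k i j m q : nat) (x y z s t e : R).

Lemma cyl_zeroE k n t : cyl k n 0 t = run_prod a k n * t.
Proof.
elim: n k => [|n IH] k; first by rewrite run_prod0 mul1r.
by rewrite cylS /= IH run_prodSl mulrA.
Qed.

Lemma diam_gt0 n : 0 < diam n.
Proof. by rewrite run_prod_gt0//; exact: lft_gt0. Qed.

Lemma diam_decreasing : decreasing_seq diam.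
Proof.
apply/decreasing_seqP => n; rewrite run_prodSr gtr_pMr ?diam_gt0//.
by have := lft_le4 w n; lra.
Qed.

Lemma diam_le m n : (m <= n)%N -> diam n <= diam m.
Proof. by rewrite -diam_decreasing. Qed.

Lemma rho_infty_has_ubound y z : in01 y -> in01 z ->
  has_ubound (range (fun i : nat => rho (iter i (g 0) y) (iter i (g 0) z))).
Proof.
by move=> y01 z01; exists 1 => _ [i _ <-]; apply: dist_in01; exact: iter_in01.
Qed.

Lemma rho_iter_le_infty y z i : in01 y -> in01 z ->
  rho (iter i (g 0) y) (iter i (g 0) z) <= rho_infty (g 0) y z.
Proof. by move=> y01 z01; apply: ub_le_sup; [exact: rho_infty_has_ubound|exists i]. Qed.

Section Orbit.
Variables (x : R) (Cx : cantor w x).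
Local Notation orb i := (iter i (g 0) x).

Lemma orbit_in01 i : in01 (orb i).
Proof. exact: iter_in01 (cantor_in01 Cx). Qed.

Lemma orbit_cyl m : exists i0, forall i, exists2 t, in01 t & orb i = cyl 0 m (i0 + i) t.
Proof.
have [i0 [t [t01 ->]]] := @Cx m I; exists i0 => i; rewrite cyl_iter//.
by eexists; last by []; exact: iter_in01.
Qed.

Lemma rho_infty_le_diam m i j :
  (i == j %[mod 2 ^ m])%N -> rho_infty (g 0) (orb i) (orb j) <= diam m.
Proof.
move=> ij; have [i0 orbE] := orbit_cyl m.
apply: ge_sup; first by exists (rho (orb i) (orb j)), 0%N.
move=> _ [l _ <-]; rewrite -!iterD /rho.
have [s s01 ->] := orbE (l + i)%N; have [t t01 ->] := orbE (l + j)%N.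
rewrite (@cyl_eqmod _ _ 0 m (i0 + (l + i)) (i0 + (l + j))); last first.
  by rewrite !eqn_modDl.
apply: le_trans (cyl_dist_le _ _ _ _ _ _) _.
by rewrite ler_piMr ?(ltW (diam_gt0 _))// dist_in01.
Qed.

Lemma first_separating_level m i j : ~~ (i == j %[mod 2 ^ m])%N ->
  exists l, [/\ (l < m)%N, (i == j %[mod 2 ^ l])%N & ~~ (i == j %[mod 2 ^ l.+1])%N].
Proof.
elim: m => [|m IH]; first by rewrite !modn1.
have [ij|/IH[l [lm ? ?]] _] := boolP (i == j %[mod 2 ^ m])%N; first by exists m.
by exists l; split=> //; exact: ltnW.
Qed.

(** Let [l] be the last level at which the two points share a cylinder.  At a suitable
    time both are in the leftmost level-[l] cylinder, the longest one, in different
    halves; the gap there is at least half of [diam l], more than [diam l.+1]. *)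
Lemma rho_infty_gt_diam m i j :
  ~~ (i == j %[mod 2 ^ m])%N -> diam m < rho_infty (g 0) (orb i) (orb j).
Proof.
move=> /first_separating_level[l [lm ij ij']].
have [i0 orbE] := orbit_cyl l.+1.
(* after [tau] steps the index of the first point is a multiple of [2 ^ l],
   so that it is in the leftmost cylinder *)
pose tau := ((i0 + i) * (2 ^ l).-1)%N.
apply: lt_le_trans (rho_iter_le_infty tau (orbit_in01 i) (orbit_in01 j)).
rewrite -!iterD /rho.
have [s s01 ->] := orbE (tau + i)%N; have [t t01 ->] := orbE (tau + j)%N.
have IE : (i0 + (tau + i) = (i0 + i) * 2 ^ l)%N.
  by rewrite addnCA /tau addnC -mulnS prednK// expn_gt0.
have JE : (i0 + (tau + j) = (i0 + (tau + j)) %/ 2 ^ l * 2 ^ l)%N.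
  apply/esym/eqP; rewrite -dvdn_eq /dvdn.
  by have := ij; rewrite -(eqn_modDl tau) -(eqn_modDl i0) IE modnMl => /eqP <-.
set v := ((i0 + (tau + j)) %/ 2 ^ l)%N in JE.
have uv : odd (i0 + i) != odd v.
  apply: contra ij' => /eqP uv; rewrite -(eqn_modDl tau) -(eqn_modDl i0) IE JE.
  by rewrite expnS -!muln_modl eqn_pmul2r ?expn_gt0// !modn2 uv.
rewrite IE JE (cyl_catr w 0 l ((i0 + i) * 2 ^ l)) (cyl_catr w 0 l (v * 2 ^ l)).
rewrite add0n !mulnK ?expn_gt0//.
have c0 u r : cyl 0 l (u * 2 ^ l) r = diam l * r.
  by rewrite -cyl_zeroE; apply: cyl_eqmod; rewrite modnMl mod0n.
rewrite !c0 -mulrBr normrM (gtr0_norm (diam_gt0 l)).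
apply: (@lt_le_trans _ _ (diam l * 2^-1)); last first.
  rewrite ler_pM2l ?diam_gt0//; apply: le_trans (gap_gt0 w l) _.
  exact: cyl_sep_odd.
apply: le_lt_trans (diam_le lm) _; rewrite run_prodSr ltr_pM2l ?diam_gt0//.
by have := lft_le4 w l; lra.
Qed.

Lemma rho_infty_diamE m i j :
  (rho_infty (g 0) (orb i) (orb j) <= diam m) = (i == j %[mod 2 ^ m])%N.
Proof.
have [/rho_infty_le_diam -> //|/rho_infty_gt_diam] := boolP (i == j %[mod 2 ^ m])%N.
by rewrite ltNge => /negbTE.
Qed.

Lemma rdet_inftyE n e : (0 < n)%N -> rdet_infty (g 0) x n e =
  #|[pred p : 'I_n * 'I_n | rho_infty (g 0) (orb p.1) (orb p.2) <= e]|%:R /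
  #|[pred p : 'I_n * 'I_n | rho (orb p.1) (orb p.2) <= e]|%:R.
Proof.
move=> n0; rewrite /rdet_infty /C_infty /C_1 /corr_sum.
rewrite invf_div mulrA divfK// expf_neq0// pnatr_eq0 -lt0n//.
Qed.

Lemma rdet_infty_in01 n e : 0 <= rdet_infty (g 0) x n e <= 1.
Proof.
case: n => [|n].
  by rewrite /rdet_infty /C_infty /corr_sum expr0n invr0 mulr0 mul0r lexx ler01.
rewrite rdet_inftyE// divr_ge0//=.
set A := #|_|; set B := #|_|.
have [B0|B0] := posnP B; first by rewrite B0 invr0 mulr0.
rewrite ler_pdivrMr ?ltr0n// mul1r ler_nat; apply: subset_leq_card.
apply/fintype.subsetP => p; rewrite !inE; apply: le_trans.
exact: (rho_iter_le_infty 0 (orbit_in01 _) (orbit_in01 _)).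
Qed.

Lemma diag_pairs_gt0 n (d : R -> R -> R) e : (0 < n)%N -> (forall y, d y y <= e) ->
  (0 < #|[pred p : 'I_n * 'I_n | (d (orb p.1) (orb p.2) <= e)%R]|)%N.
Proof.
by move=> n0 de; apply/card_gt0P; exists (Ordinal n0, Ordinal n0); rewrite inE /=.
Qed.

(** Below the smallest gap of level [q.+1], being close now already means being in the
    same cylinder, hence being close for ever. *)
Lemma rdet_infty_eq1 q n : diam q.+1 < 2^-1 * run_prod b 0 q -> (0 < n)%N ->
  rdet_infty (g 0) x n (diam q.+1) = 1.
Proof.
move=> small n0; rewrite rdet_inftyE//.
have [i0 orbE] := orbit_cyl q.+1.
set A := #|_|; set B := #|_|; suff -> : A = B.
  rewrite divff// pnatr_eq0 -lt0n; apply: diag_pairs_gt0 => // y.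
  by rewrite /rho subrr normr0 ltW ?diam_gt0.
apply: eq_card => -[i j]; rewrite !inE /= rho_infty_diamE.
apply/idP/idP => [ij|]; last first.
  apply: contraTT => ij; rewrite -ltNge; apply: lt_le_trans small _.
  rewrite /rho; have [s s01 ->] := orbE i; have [t t01 ->] := orbE j.
  by apply: cyl_sep => //; rewrite eqn_modDl.
apply: le_trans (rho_infty_le_diam ij).
exact: (rho_iter_le_infty 0 (orbit_in01 _) (orbit_in01 _)).
Qed.

(** Points in a cylinder of level [q.+1] with last digit [1] are within
    [diam q * b q] of each other, so half of the cylinders of that level count
    entirely for the Euclidean distance, whereas [rho_infty] requires agreement
    up to level [m]. *)
Lemma rdet_infty_small q m n : (q < m)%N -> diam q * b q <= diam m -> (2 ^ m <= n)%N ->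
  rdet_infty (g 0) x n (diam m) <= 16 * 2 ^+ q.+1 / 2 ^+ m.
Proof.
move=> qm small mn; have n0 : (0 < n)%N by apply: leq_trans mn; rewrite expn_gt0.
rewrite rdet_inftyE//; set A := #|_|; set B := #|_|.
have B0 : (0 < B)%N.
  by apply: diag_pairs_gt0 => // y; rewrite /rho subrr normr0 ltW ?diam_gt0.
have AM : (A <= n * (n %/ 2 ^ m).+1)%N.
  rewrite /A (eq_card (B := [pred p : 'I_n * 'I_n | p.1 == p.2 %[mod 2 ^ m]])).
    by apply: card_eqmod_pairs_le; rewrite expn_gt0.
  by move=> p; rewrite !inE rho_infty_diamE.
have [i0 orbE] := orbit_cyl q.+1.
have N0 : (0 < 2 ^ q.+1)%N by rewrite expn_gt0.
(* the times at which the index is [2 ^ q + r], that is, has digit [1] in position [q] *)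
pose c (r : nat) := ((2 ^ q + r + (2 ^ q.+1 - i0 %% 2 ^ q.+1)) %% 2 ^ q.+1)%N.
have cE u r : (i0 + (u * 2 ^ q.+1 + c r) == 2 ^ q + r %[mod 2 ^ q.+1])%N.
  rewrite addnCA modnMDl modnDmr -modnDml.
  rewrite addnCA subnKC; last by rewrite ltnW// ltn_mod.
  by rewrite modnDr.
have BN : ((n %/ 2 ^ q.+1) * (n %/ 2 ^ q.+1) * 2 ^ q <= B)%N.
  apply: (@card_pairs_ge n (2 ^ q.+1) (2 ^ q) c
    (fun i j => rho (orb i) (orb j) <= diam m)) => [r|r r'|u v r rq].
  - by rewrite ltn_mod.
  - rewrite !inE => rq rq' cc.
    have := cE 0%N r; rewrite cc; have /eqP -> := cE 0%N r'.
    rewrite eqn_modDl !modn_small ?expnS ?mul2n -?addnn; last 2 first.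
    + by apply: leq_trans rq _; rewrite leq_addr.
    + by apply: leq_trans rq' _; rewrite leq_addr.
    by move=> /eqP.
  have digit1 : ((2 ^ q + r) %/ 2 ^ q = 1)%N.
    by rewrite divnDl// divnn expn_gt0/= divn_small.
  rewrite /rho; have [s s01 ->] := orbE (u * 2 ^ q.+1 + c r)%N.
  have [t t01 ->] := orbE (v * 2 ^ q.+1 + c r)%N.
  rewrite !(@cyl_eqmod _ w 0 q.+1 _ _ _ (cE _ _)) !(cyl_catr w 0 q) digit1 add0n.
  apply: le_trans small; apply: le_trans (cyl_dist_le _ _ _ _ _ _) _.
  rewrite ler_pM2l ?diam_gt0// /= opprD addrACA subrr add0r -mulrBr normrM.
  by rewrite gtr0_norm ?rgt_gt0// ler_piMr ?(ltW (rgt_gt0 w q))// dist_in01.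
rewrite ler_pdivrMr ?ltr0n// mulrAC ler_pdivlMr ?exprn_gt0//.
rewrite -!natrX -!natrM ler_nat.
apply: (@card_pairs_ratio n (2 ^ m) (2 ^ q.+1) (2 ^ q)) => //.
- by rewrite expn_gt0.
- by rewrite leq_pexp2l.
- by rewrite expnS.
Qed.

End Orbit.
End RecurrenceDeterminism.

(** * Sparse ratios *)

Section SparseRatios.
Context {R : realType}.
Implicit Types (q k n d : nat).

Definition pow2 q := (q == 2 ^ trunc_log 2 q)%N.

(** The shortest length at level [q], defined together with the ratios because the
    exceptional ratios are chosen small with respect to it. *)
Fixpoint min_len q : R :=
  if q is p.+1 then
    min_len p * (if pow2 p then min_len p / 4 * 4^-1 ^+ p else 4^-1)
  else 1.

(** At a power of two, the length of every cylinder drops below all earlier gaps. *)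
Definition sparse_lft q : R := if pow2 q then min_len q / 4 else 4^-1.
(** At a power of two the right ratio is smaller than the left one by [4 ^ q], which
    outweighs the product of the following [q - 1] ratios, all equal to [1/4]. *)
Definition sparse_rgt q : R := if pow2 q then min_len q / 4 * 4^-1 ^+ q else 4^-1.

Lemma min_len_bounds q : 0 < min_len q <= 1.
Proof.
elim: q => [|q /andP[m0 m1]] /=; first by rewrite ltr01 lexx.
have e0 : 0 < 4^-1 ^+ q :> R by apply: exprn_gt0; lra.
have e1 : 4^-1 ^+ q <= 1 :> R by apply: exprn_ile1; lra.
case: ifP => _; apply/andP; split; try by rewrite !mulr_gt0.
  by rewrite !mulr_ile1 ?mulr_ge0 ?(ltW m0) ?(ltW e0)//; lra.
by lra.
Qed.

Lemma sparse_rgt_gt0 q : 0 < sparse_rgt q.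
Proof.
have /andP[m0 _] := min_len_bounds q; rewrite /sparse_rgt; case: ifP => _ //.
by rewrite !mulr_gt0// exprn_gt0.
Qed.

Lemma sparse_rgt_le_lft q : sparse_rgt q <= sparse_lft q.
Proof.
have /andP[m0 _] := min_len_bounds q; rewrite /sparse_rgt /sparse_lft.
case: ifP => _ //; rewrite ler_piMr ?mulr_ge0 ?(ltW m0)//.
by apply: exprn_ile1; lra.
Qed.

Lemma sparse_lft_le4 q : sparse_lft q <= 4^-1.
Proof.
have /andP[m0 m1] := min_len_bounds q; rewrite /sparse_lft; case: ifP => _ //; lra.
Qed.

Definition sparse := Ratios sparse_rgt_gt0 sparse_rgt_le_lft sparse_lft_le4.

Lemma run_prod_sparse_rgt q : run_prod (rgt sparse) 0 q = min_len q.
Proof. by elim: q => [|q IH]; rewrite ?run_prod0// run_prodSr IH. Qed.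

Lemma pow2_exp k : pow2 (2 ^ k).
Proof. by rewrite /pow2 trunc_expnK. Qed.

Lemma pow2_between k d : (d.+1 < 2 ^ k)%N -> pow2 (2 ^ k + d.+1) = false.
Proof.
move=> dk; rewrite /pow2 (_ : trunc_log _ _ = k).
  by rewrite -[X in _ == X]addn0 eqn_add2l.
by apply: trunc_log_eq => //; rewrite leq_addr expnS mul2n -addnn ltn_add2l.
Qed.

Lemma diam_sparse_run k d : (d < 2 ^ k)%N ->
  run_prod (lft sparse) 0 (2 ^ k + d.+1) =
  run_prod (lft sparse) 0 (2 ^ k) * (min_len (2 ^ k) / 4) * 4^-1 ^+ d.
Proof.
elim: d => [|d IH] dk.
  by rewrite addn1 run_prodSr add0n /= /sparse_lft pow2_exp expr0 mulr1.
rewrite addnS run_prodSr IH ?(ltnW dk)// add0n /= /sparse_lft pow2_between//.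
by rewrite exprSr !mulrA.
Qed.

Lemma diam_sparse_small k :
  run_prod (lft sparse) 0 (2 ^ k).+1 < 2^-1 * run_prod (rgt sparse) 0 (2 ^ k).
Proof.
rewrite run_prodSr run_prod_sparse_rgt add0n /= /sparse_lft pow2_exp.
have /andP[m0 m1] := min_len_bounds (2 ^ k).
have D1 := @diam_le _ sparse 0 (2 ^ k) (leq0n _); rewrite run_prod0 in D1.
have D0 := diam_gt0 sparse (2 ^ k); nra.
Qed.

Lemma sparse_rgt_small k :
  run_prod (lft sparse) 0 (2 ^ k) * rgt sparse (2 ^ k)
    <= run_prod (lft sparse) 0 (2 ^ k.+1).
Proof.
have e0 : (0 < 2 ^ k)%N by rewrite expn_gt0.
have -> : (2 ^ k.+1 = 2 ^ k + (2 ^ k).-1.+1)%N by rewrite prednK// expnS mul2n addnn.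
rewrite diam_sparse_run ?prednK// /= /sparse_rgt pow2_exp mulrA.
have /andP[m0 m1] := min_len_bounds (2 ^ k).
rewrite ler_pM2l; last by apply: mulr_gt0; [exact: (diam_gt0 sparse)|exact: divr_gt0].
by apply: ler_wiXn2l; rewrite ?leq_pred//; lra.
Qed.

End SparseRatios.

(** * The two families of scales *)

Section Conclusion.
Context {R : realType}.
Local Notation w := (@sparse R).
Local Notation f := (renorm_map w 0).
Local Notation diam := (run_prod (lft w) 0).

(** Both sequences of scales are subsequences of [diam]. *)
Lemma diam_subseq_decreasing_to_zero (s : nat -> nat) :
  (forall m n, (s m <= s n) = (m <= n))%N -> (forall k, k <= s k)%N ->
  decreasing_to_zero (fun k => diam (s k)).
Proof.
move=> smono sge; split=> [k|m n|]; first exact: diam_gt0.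
  by rewrite diam_decreasing smono.
apply: (@squeeze_cvgr _ _ _ _ (fun=> 0) (fun k => 2^-1 ^+ k)).
- near=> k; rewrite ltW ?diam_gt0//=; apply: le_trans (diam_le w (sge k)) _.
  exact: lft_run_le.
- exact: cvg_cst.
- by apply: cvg_expr; rewrite ger0_norm; lra.
Unshelve. all: by end_near. Qed.

Lemma at_right_meets (u : nat -> R) (V : set R) :
  decreasing_to_zero u -> (0 : R)^'+ V -> exists N, forall k, (N <= k)%N -> V (u k).
Proof.
move=> [u0 _ ucvg] /nbhs_ballP[e e0 eV].
move: ucvg => /cvgrPdist_lt/(_ e e0)[N _ h]; exists N => k Nk.
by apply: eV; [exact: h|exact: u0].
Qed.

Variables (x : R) (Cx : cantor w x).

Lemma lower_rdet_bounds e : (0 <= lower_rdet f x e <= 1)%E.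
Proof.
have r01 n := rdet_infty_in01 Cx n e; apply/andP; split.
  apply: limf_einf_ge; exists 0%N => // n _ /=; rewrite lee_fin.
  by have /andP[] := r01 n.
apply: limf_einf_le => V [N _ VN]; exists N; first exact: VN (leqnn N).
by rewrite lee_fin; have /andP[] := r01 N.
Qed.

Lemma upper_rdet_ge0 e : (0 <= upper_rdet f x e)%E.
Proof.
have /andP[l0 _] := lower_rdet_bounds e.
by apply: le_trans l0 _; exact: limn_einf_sup.
Qed.

Lemma rdet_eq1 k : rdet_eq f x (diam (2 ^ k).+1) 1.
Proof.
have c : (fun n => (rdet_infty f x n (diam (2 ^ k).+1))%:E) @ \oo --> (1 : R)%:E.
  apply: cvg_near_cst; exists 1%N => // n /= n0.
  by rewrite (rdet_infty_eq1 Cx (diam_sparse_small k) n0).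
by split; rewrite /lower_rdet /upper_rdet;
  [have [-> _] := cvg_limn_einf_sup c|have [_ ->] := cvg_limn_einf_sup c].
Qed.

Lemma upper_rdet_le k :
  (upper_rdet f x (diam (2 ^ k.+1)) <= (32 * 2^-1 ^+ k)%:E)%E.
Proof.
apply: limf_esup_le; exists (2 ^ 2 ^ k.+1)%N => // n /= nk; rewrite lee_fin.
have qm : (2 ^ k < 2 ^ k.+1)%N by rewrite ltn_exp2l.
apply: le_trans (rdet_infty_small Cx qm (sparse_rgt_small k) nk) _.
have -> : (2 ^ k.+1 = 2 ^ k + 2 ^ k)%N by rewrite expnS mul2n addnn.
have p0 : 0 < 2 ^+ (2 ^ k)%N :> R by apply: exprn_gt0.
rewrite exprD exprS invfM; set E := _ ^+ (2 ^ k).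
have E0 : E != 0 by exact: lt0r_neq0 p0.
have -> : 16 * (2 * E) * (E^-1 / E) = 32 * E^-1.
  by field.
rewrite ler_pM2l// /E -exprVn; apply: ler_wiXn2l; rewrite ?(ltnW (ltn_expl _ _))//; lra.
Qed.

Lemma upper_rdet_cvg0 : upper_rdet f x (diam (2 ^ k.+1)) @[k --> \oo] --> 0%E.
Proof.
apply: (@squeeze_cvge _ _ _ _ (fun=> 0%E) _ (fun k => (32 * 2^-1 ^+ k)%:E)).
- by near=> k; rewrite upper_rdet_ge0 upper_rdet_le.
- exact: cvg_cst.
- have -> : 0%E = (32 * 0 : R)%:E by rewrite mulr0.
  apply: cvg_EFin; first exact: nearW.
  apply: cvgMr; apply: cvg_expr; rewrite ger0_norm; lra.
Unshelve. all: by end_near. Qed.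

End Conclusion.

Theorem theorem3 (R : realType) :
  exists f : R -> R,
    [/\ continuous_self_map f, ~ li_yorke_chaotic f, type_2infty f &
      exists C : set R,
        unique (fun M : set R => minimal_set f M /\ infinite_set M) C /\
        exists eps eps' : nat -> R,
          [/\ decreasing_to_zero eps, decreasing_to_zero eps',
            (forall x : R, C x ->
               (forall k : nat, rdet_eq f x (eps k) 1) /\
               upper_rdet f x (eps' k) @[k --> \oo] --> 0%E) &
            (forall x : R, C x ->
               limf_esup (lower_rdet f x) (0 : R)^'+ = 1%E /\
               limf_einf (upper_rdet f x) (0 : R)^'+ = 0%E)]].
Proof.
pose w := @sparse R.
exists (renorm_map w 0); split; [exact: renorm_map_self_map|
  exact: not_li_yorke_chaotic|exact: renorm_map_type_2infty|].
exists (cantor w); split; first exact: cantor_unique.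
exists (fun k => run_prod (lft w) 0 (2 ^ k).+1), (fun k => run_prod (lft w) 0 (2 ^ k.+1)).
have d1 : decreasing_to_zero (fun k => run_prod (lft w) 0 (2 ^ k).+1).
  apply: (@diam_subseq_decreasing_to_zero _ (fun k => (2 ^ k).+1)) => [m n|k].
    by rewrite ltnS leq_exp2l.
  by rewrite ltnW// ltnS ltnW// ltn_expl.
have d2 : decreasing_to_zero (fun k => run_prod (lft w) 0 (2 ^ k.+1)).
  apply: (@diam_subseq_decreasing_to_zero _ (fun k => (2 ^ k.+1)%N)) => [m n|k].
    by rewrite leq_exp2l.
  by rewrite ltnW// (ltn_trans (ltn_expl k (isT : 1 < 2)%N))// ltn_exp2l.
split=> // x Cx; first by split; [exact: rdet_eq1|exact: upper_rdet_cvg0].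
split; apply/eqP; rewrite eq_le; apply/andP; split.
- apply: limf_esup_le; apply: nearW => e /=.
  by have /andP[] := lower_rdet_bounds Cx e.
- apply: limf_esup_ge => V /(at_right_meets d1)[N VN].
  exists (run_prod (lft w) 0 (2 ^ N).+1); first exact: (VN N).
  by have [-> _] := rdet_eq1 Cx N.
- apply/lee_addgt0Pr => e e0; rewrite add0e.
  apply: limf_einf_le => V /(at_right_meets d2)[N VN].
  have [n ne] := ex_half_pow_le (divr_gt0 e0 (ltr0n R 32)).
  pose k := (N + n)%N.
  exists (run_prod (lft w) 0 (2 ^ k.+1)); first by apply: VN; exact: leq_addr.
  apply: le_trans (upper_rdet_le Cx k) _; rewrite lee_fin -ler_pdivlMl// mulrC.
  apply: le_trans ne; apply: ler_wiXn2l; rewrite ?leq_addl//; lra.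
- by apply: limf_einf_ge; apply: nearW => e _; exact: upper_rdet_ge0.
Qed.
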